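(* There exists a system $(\mathbf{A}^{\mathbb{Z}^2},\mathbb{P},\{T^z\}_{z\in\mathbb{Z}^2})$ that almost surely has bi-infinite walks and such that the bi-infinite trajectory system $(\Omega_\alpha,\mathbb{P}_\alpha,T_\alpha)$ has positive entropy.
   Context: Here $\mathbf{A}=\{e_1,e_2\}$ is the set of arrows (standard basis vectors of $\mathbb{Z}^2$, so walks are directed nearest-neighbor walks), $\mathbb{P}$ is a translation-invariant Borel probability measure on $\mathbf{A}^{\mathbb{Z}^2}$, and $(T^z\omega)(x)=\omega(x+z)$. The value $\alpha(\omega,x)=\omega(x)$ is the arrow at $x$, and $\alpha(\omega)=\omega(\mathbf{0})$. For each $x\in\mathbb{Z}^2$ the walk $X_x(\omega,\cdot)$ is defined by $X_x(\omega,0)=x$ and $X_x(\omega,k+1)=X_x(\omega,k)+\alpha(\omega,X_x(\omega,k))$, $k\ge0$. A point $z\in\mathbb{Z}^2$ is bi-infinite (in $\omega$) if there is an infinite backward sequence of points $a_1,a_2,\dots\in\mathbb{Z}^2$ with $X_{a_1}(\omega,1)=z$ and $X_{a_{n+1}}(\omega,1)=a_n$ for all $n\ge1$; the walk through such a point, extended backward along the $a_n$, is a bi-infinite walk (trajectory). $\Omega_\alpha$ is the event that the origin is bi-infinite, $\mathbb{P}_\alpha(B)=\mathbb{P}(B\cap\Omega_\alpha)$, and $T_\alpha\omega=T^{\alpha(\omega)}\omega$. It is a known fact that $(\Omega_\alpha,\mathbb{P}_\alpha,T_\alpha)$ is an invertible measure-preserving $\mathbb{Z}$-system. Positive entropy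 means that the Kolmogorov–Sinai entropy of $T_\alpha$ with respect to $\mathbb{P}_\alpha$, i.e. the supremum over finite measurable partitions of the entropy rate, is positive. *)

(* Defs.v *)
From HB Require Import structures.
From mathcomp Require Import all_boot all_order all_algebra.
From mathcomp Require Import all_classical all_reals all_analysis.

Set Implicit Arguments.
Unset Strict Implicit.
Unset Printing Implicit Defensive.

Import Order.TTheory GRing.Theory Num.Theory.
Import numFieldNormedType.Exports.

Local Open Scope classical_set_scope.
Local Open Scope ring_scope.

Definition Z2 : Type := (int * int)%type.
HB.instance Definition _ := GRing.Zmodule.on Z2.

(* The two-letter set {e_1, e_2} is encoded by bool, which carries the discrete
   topology; [arrow_vec] sends [false] to e_1 and [true] to e_2. *)
Definition arrow : Type := bool.
HB.instance Definition _ := Topological.on arrow.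
HB.instance Definition _ := Pointed.on arrow.

Definition arrow_vec (a : arrow) : Z2 :=
  if a then (0%R : int, 1%R : int) else (1%R : int, 0%R : int).

(* Borel sigma-algebra of the product topology. *)
Definition config : Type :=
  g_sigma_algebraType (@open (prod_topology (fun _ : Z2 => arrow))).
HB.instance Definition _ := Measurable.on config.

Definition shift (z : Z2) (w : config) : config := fun x => w (x + z).

Definition alpha (w : config) (x : Z2) : Z2 := arrow_vec (w x).

Fixpoint walk (w : config) (x : Z2) (k : nat) : Z2 :=
  if k is k'.+1 then walk w x k' + alpha w (walk w x k') else x.

(* [a n] is the (n+1)-st backward point. *)
Definition bi_infinite (w : config) (z : Z2) : Prop :=
  exists a : nat -> Z2,
    walk w (a 0%N) 1 = z /\ forall n, walk w (a n.+1) 1 = a n.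

Definition Omega_alpha : set config := [set w | bi_infinite w 0].

Definition T_alpha (w : config) : config := shift (alpha w 0) w.

Lemma measurable_arrow (x : Z2) (a : arrow) :
  measurable [set w : config | w x = a].
Proof.
apply: sub_sigma_algebra.
have -> : [set w : config | w x = a] =
    (@proj Z2 (fun=> arrow) x) @^-1` [set a] by [].
apply: (@open_comp (prod_topology (fun _ : Z2 => arrow)) arrow).
  by move=> f _; exact: proj_continuous.
exact: (@discrete_open bool).
Qed.

Fixpoint back_reach (n : nat) (z : Z2) : set config :=
  if n is n'.+1 then
    \bigcup_(a : arrow)
      ([set w | w (z - arrow_vec a) = a] `&` back_reach n' (z - arrow_vec a))
  else setT.

Lemma measurable_back_reach n z : measurable (back_reach n z).
Proof.
elim: n z => [|n IHn] z /=; first exact: measurableT.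
apply: (@fin_bigcup_measurable _ _ bool); first exact: finite_finset.
by move=> a _; apply: measurableI; [exact: measurable_arrow|exact: IHn].
Qed.

Lemma back_reachS n z : back_reach n.+1 z `<=` back_reach n z.
Proof.
elim: n z => [//|n IHn] z w [a _ [wa Ha]].
by exists a => //; split => //; exact: IHn.
Qed.

Lemma back_reach_le m n z : (m <= n)%N -> back_reach n z `<=` back_reach m z.
Proof.
move=> /subnK <-; elim: (n - m)%N => [//|k IHk].
by rewrite addSn; apply: subset_trans IHk; exact: back_reachS.
Qed.

Lemma bi_infiniteP w z : bi_infinite w z <-> forall n, back_reach n z w.
Proof.
split.
- move=> [a [a0 aS]] n.
  elim: n z a a0 aS => [//|n IHn] z a /= a0 aS.
  have -> : z = a 0%N + alpha w (a 0%N) by rewrite a0.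
  exists (w (a 0%N)) => //; rewrite /alpha addrK; split=> //.
  by apply: (IHn _ (a \o succn)) => [|k] /=; exact: aS.
- move=> Hz.
  have step (y : Z2) : exists a : arrow, (forall n, back_reach n y w) ->
      w (y - arrow_vec a) = a /\ forall n, back_reach n (y - arrow_vec a) w.
    have [yw|nyw] := pselect (forall n, back_reach n y w); last by exists false.
    apply: contrapT => /forallNP H.
    have bad a : w (y - arrow_vec a) = a ->
        exists n, ~ back_reach n (y - arrow_vec a) w.
      by move=> wa; apply/existsNP => Hn; apply: (H a) => _; split.
    have {}bad a : exists n, ~ (w (y - arrow_vec a) = a /\
                                back_reach n (y - arrow_vec a) w).
      have [/bad[n Hn]|Hn] := pselect (w (y - arrow_vec a) = a).
        by exists n => -[].
      by exists 0%N => -[].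
    have [n Hn] := choice bad.
    have [a _ [wa Ha]] := yw (maxn (n false) (n true)).+1.
    apply: (Hn a); split=> //; apply: back_reach_le Ha.
    by case: a {wa}; rewrite leq_max leqnn ?orbT.
  have [g Hg] := choice step.
  pose p (y : Z2) : Z2 := y - arrow_vec (g y).
  have Hp k : forall n, back_reach n (iter k p z) w.
    by elim: k => [//|k IHk] /=; have [] := Hg _ IHk.
  have pE k : walk w (iter k.+1 p z) 1 = iter k p z.
    have [wk _] := Hg _ (Hp k).
    by rewrite /= /alpha {2}/p wk subrK.
  by exists (fun n => iter n.+1 p z); split=> [|n]; exact: pE.
Qed.

Lemma measurable_Omega_alpha : measurable Omega_alpha.
Proof.
have -> : Omega_alpha = \bigcap_n back_reach n 0.
  by apply/seteqP; split=> [w /bi_infiniteP H n _|w H];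
    [exact: H|apply/bi_infiniteP => n; exact: H].
by apply: bigcap_measurable => // n _; exact: measurable_back_reach.
Qed.

Section translation_invariant.
Context {R : realType}.
Variable P : probability config R.

Definition translation_invariant : Prop :=
  forall (z : Z2) (B : set config), measurable B -> P (shift z @^-1` B) = P B.

(* P_alpha(B) = P(B `&` Omega_alpha), not normalized. *)
Definition P_alpha : {measure set config -> \bar R} :=
  mrestr P measurable_Omega_alpha.

End translation_invariant.

(* Kolmogorov-Sinai entropy of a map [f] on the carrier [X] with respect to a
   finite measure [mu] concentrated on [X].  [mu] need not have mass one:
   with m = mu X, the rate of a partition is m times the rate for mu / m, since
   the term - m ln m is constant and vanishes after division by n; so the sign
   of the entropy does not depend on normalization. *)
Section entropy.
Context {d : measure_display} {T : measurableType d} {R : realType}.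
Variables (mu : {measure set T -> \bar R}) (X : set T) (f : T -> T).

Definition measurable_partition (k : nat) (A : 'I_k -> set T) : Prop :=
  partition [set: 'I_k] A X /\ forall i, measurable (A i).

(* The convention 0 ln 0 = 0 holds by [ln0]. *)
Definition shannon (I : finType) (A : I -> set T) : R :=
  - \sum_(i : I) fine (mu (A i)) * ln (fine (mu (A i))).

(* The cells of the join of A, f^-1 A, ..., f^-(n-1) A, indexed by words. *)
Definition join_cell (k : nat) (A : 'I_k -> set T) (n : nat)
    (u : {ffun 'I_n -> 'I_k}) : set T :=
  [set x | forall i : 'I_n, A (u i) (iter i f x)].

Definition entropy_rate (k : nat) (A : 'I_k -> set T) : R :=
  limn (fun n : nat => shannon (@join_cell k A n) / n%:R).

Definition ks_entropy : \bar R :=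
  ereal_sup [set h | exists (k : nat) (A : 'I_k -> set T),
                       measurable_partition A /\ h = (entropy_rate A)%:E].

End entropy.

(* Main.v *)
(* Let the arrows be constant along antidiagonals: the arrow at [z] is a fair bit
   attached to the level [z.1 + z.2], the bits of distinct levels being
   independent.  Each step of a walk raises the level by one, so every point has
   exactly one predecessor (its direction is the bit of the level below), every
   point is bi-infinite, and T_alpha acts as the Bernoulli shift on the bits,
   whose entropy is ln 2.  The independent bits are the binary digits of a
   Lebesgue-distributed point of [0, 1[, the levels being numbered by [pickle]. *)
Require Import Defs.
From HB Require Import structures.
From mathcomp Require Import all_boot all_order all_algebra.
From mathcomp Require Import all_classical all_reals all_analysis.
From mathcomp Require Import measurable_realfun lra.

Set Implicit Arguments.
Unset Strict Implicit.
Unset Printing Implicit Defensive.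

Import Order.TTheory GRing.Theory Num.Theory.
Import numFieldNormedType.Exports.

Local Open Scope classical_set_scope.
Local Open Scope ring_scope.

Lemma uniq_keys_inj (K V : eqType) (s : seq (K * V)) p q :
  uniq (unzip1 s) -> p \in s -> q \in s -> p.1 = q.1 -> p = q.
Proof.
elim: s => //= r s IHs /andP[rs us].
rewrite !inE => /orP[/eqP->|ps] /orP[/eqP->|qs] // e.
- by move: rs; rewrite e map_f.
- by move: rs; rewrite -e map_f.
- exact: IHs.
Qed.

(** * Binary digits as independent fair bits *)

Section binary_digits.
Context {R : realType}.
Implicit Types (x : R) (u : nat -> bool).

(** On [[0, 1[] this is x -> 2x mod 1, so [digit n] is the binary digit of weight 2^-(n+1). *)
Definition doubling x : R := if 2^-1 <= x then 2 * x - 1 else 2 * x.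

Definition digit (n : nat) x : bool := 2^-1 <= iter n doubling x.

Lemma measurable_doubling : measurable_fun [set: R] doubling.
Proof.
apply: measurable_fun_ifT.
- by apply: measurable_fun_ler => //; exact: measurable_cst.
- by apply: measurable_funB => //; exact: mulrl_measurable.
- exact: mulrl_measurable.
Qed.

Lemma measurable_iter_doubling n : measurable_fun [set: R] (iter n doubling).
Proof.
elim: n => [|n IHn]; first exact: measurable_id.
by apply: (measurableT_comp measurable_doubling IHn).
Qed.

Lemma measurable_digit n b : measurable [set x | digit n x = b].
Proof.
have mdig : measurable_fun [set: R] (digit n).
  apply: measurable_fun_ler; first exact: measurable_cst.
  exact: measurable_iter_doubling.
rewrite -[X in measurable X]setTI.
exact: (mdig measurableT [set b] I).
Qed.

Definition digits_cyl (s : seq (nat * bool)) : set R :=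
  [set x | all (fun p => digit p.1 x == p.2) s].

Lemma digits_cyl_cons p s :
  digits_cyl (p :: s) = [set x | digit p.1 x = p.2] `&` digits_cyl s.
Proof.
apply/seteqP; split=> x /=; rewrite /digits_cyl /=.
  by case/andP => /eqP.
by case=> -> ->; rewrite eqxx.
Qed.

Lemma measurable_digits_cyl s : measurable (digits_cyl s).
Proof.
elim: s => [|p s IHs]; first by rewrite [X in measurable X]set_true.
by rewrite digits_cyl_cons; apply: measurableI => //; exact: measurable_digit.
Qed.

(** Induction on [N], peeling off the first digit: [doubling] maps each half of [[0, 1[] affinely
    onto [[0, 1[], so one more leading digit pulls the interval back along one branch. The bounds on
    [a] keep the result inside the half selected by that digit. *)
Lemma prefix_itv N u : exists2 a : R, 0 <= a /\ a + 2^-1 ^+ N <= 1 &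
  `[0, 1[%classic `&` [set x | forall i, (i < N)%N -> digit i x = u i] =
  `[a, a + 2^-1 ^+ N[%classic.
Proof.
elim: N u => [|N IHN] u.
  exists 0; first by rewrite expr0 add0r.
  by rewrite expr0 add0r; apply/seteqP; split=> [x []|x] //=; split.
have [a [a0 a1] aE] := IHN (u \o succn).
have e0 : 0 < (2^-1 : R) ^+ N by rewrite exprn_gt0// invr_gt0.
(* The image of [a] under the inverse branch of [doubling] selected by [u 0]. *)
exists ((a + (u 0)%:R) / 2).
  by rewrite exprS; case: (u 0) => /=; split; lra.
have dE x : (forall i, (i < N.+1)%N -> digit i x = u i) <->
    (2^-1 <= x) = u 0 /\
    forall i, (i < N)%N -> digit i (doubling x) = (u \o succn) i.
  split=> [H|[H0 H] [|i] iN]; [|exact: H0|].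
    by split=> [|i iN]; [exact: (H 0)|rewrite /digit -iterSr; exact: H].
  by rewrite /digit iterSr; exact: H.
have stepE x : ((doubling x \in `[0, 1[) /\
    forall i, (i < N)%N -> digit i (doubling x) = (u \o succn) i) <->
    doubling x \in `[a, a + 2^-1 ^+ N[.
  by move/seteqP: aE => [/(_ (doubling x)) + /(_ (doubling x))].
apply/seteqP; split=> x /=.
  move=> [x01 /dE[x0 xS]].
  have dx01 : doubling x \in `[0, 1[.
    by move: x01; rewrite !in_itv /= /doubling; case: ifPn => ?; lra.
  have /stepE := conj dx01 xS.
  rewrite !in_itv /= /doubling x0 exprS; case: (u 0) => /=; lra.
move=> xI.
have x0 : (2^-1 <= x) = u 0.
  move: xI; rewrite in_itv /= exprS; case: (u 0) => /= xI; first by lra.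
  by apply/negbTE; rewrite -ltNge; lra.
have /stepE[dx01 xS] : doubling x \in `[a, a + 2^-1 ^+ N[.
  move: xI; rewrite !in_itv /= /doubling x0 exprS.
  by case: (u 0) => /=; lra.
split; last by apply/dE.
by move: dx01 x0; rewrite !in_itv /= /doubling => + x0; rewrite x0;
  case: (u 0) x0; lra.
Qed.

(* Induction on the number of unconstrained digits below a bound N: freezing one
   more digit splits the cylinder into two cylinders of equal measure, until the
   first N digits are all prescribed and the cylinder is a dyadic interval. *)
Lemma lebesgue_digits_cyl s : uniq (unzip1 s) ->
  lebesgue_measure (`[0, 1[%classic `&` digits_cyl s) =
    (2^-1 ^+ size s)%:E :> \bar R.
Proof.
have [N sN] : exists N, forall i, i \in unzip1 s -> (i < N)%N.
  exists (\max_(i <- unzip1 s) i).+1 => i si.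
  by rewrite ltnS; exact: (@leq_bigmax_seq _ _ xpredT id).
move: {2}(N - size s)%N (erefl (N - size s)%N) => k.
elim: k s sN => [|k IHk] s sN ks us.
  (* No digit below [N] is free: the positions are distinct, below [N], and at least [N] in
     number. *)
  have mem_s i : (i < N)%N -> i \in unzip1 s.
    move=> iN.
    have := @uniq_min_size _ (unzip1 s) (iota 0 N) us.
    case.
    - by move=> j /sN; rewrite mem_iota.
    - by rewrite size_iota size_map -subn_eq0 ks.
    - by move=> _ /(_ i) ->; rewrite mem_iota.
  have sizes : size s = N.
    apply/eqP; rewrite eqn_leq -[X in _ && X]subn_eq0 ks eqxx andbT.
    rewrite -(size_map fst) -[X in (_ <= X)%N](size_iota 0).
    by apply: uniq_leq_size => // j /sN; rewrite mem_iota.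
  (* Distinct positions make [s] the graph of a function; [u] extends it by [false]. *)
  pose u i := (i, true) \in s.
  have uE p : p \in s -> u p.1 = p.2.
    case: p => i [] //= ps; apply/negbTE/negP => its.
    by have := uniq_keys_inj us ps its erefl.
  have [a [a0 a1] aE] := prefix_itv N u.
  have -> : digits_cyl s = [set x | forall i, (i < N)%N -> digit i x = u i].
    apply/seteqP; split=> x /=.
      move=> /allP xs i iN; have /mapP[p ps ->] := mem_s _ iN.
      by rewrite uE //; exact/eqP/xs.
    by move=> xu; apply/allP => p ps; rewrite xu ?uE// sN// map_f.
  rewrite aE lebesgue_measure_itv /= lte_fin ltrDl.
  rewrite exprn_gt0 ?invr_gt0// sizes -EFinB; congr (_%:E); lra.
(* Here [s] has fewer than [N] entries, so by counting some digit below [N] is free. *)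
have [i iN nis] : exists2 i, (i < N)%N & i \notin unzip1 s.
  apply: contrapT => /forall2NP sall.
  have : (size (iota 0 N) <= size (unzip1 s))%N.
    apply: uniq_leq_size; first exact: iota_uniq.
    move=> i; rewrite mem_iota /= => iN.
    by have [/(_ iN)|/negP/negPn] := sall i.
  by rewrite size_iota size_map -subn_eq0 ks.
pose D b := `[0, 1[%classic `&` digits_cyl ((i, b) :: s).
have mD b : measurable (D b).
  by apply: measurableI => //; exact: measurable_digits_cyl.
have -> : `[0, 1[%classic `&` digits_cyl s = D true `|` D false.
  rewrite /D !digits_cyl_cons -setIUr -setIUl; congr (_ `&` _).
  rewrite -[LHS]setTI; congr (_ `&` _); apply/seteqP; split=> // x _ /=.
  by case: (digit i x); [left|right].
have D0 : D true `&` D false = set0.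
  by rewrite /D !digits_cyl_cons; apply/seteqP; split=> // x /=;
    move=> [[_ [->]] _ [_ []]].
have De b : lebesgue_measure (D b) = (2^-1 ^+ (size s).+1)%:E.
  apply: IHk.
  - by move=> j; rewrite /= inE => /orP[/eqP->|/sN].
  - by rewrite /= subnS ks.
  - by rewrite /= nis.
rewrite measureU; [|exact: mD|exact: mD|exact: D0].
transitivity ((2^-1 : R) ^+ (size s).+1 + 2^-1 ^+ (size s).+1)%:E.
  by rewrite EFinD; congr (_ + _)%E; exact: De.
by congr (_%:E); rewrite exprS; lra.
Qed.

End binary_digits.

(** * The sigma-algebra of configurations *)

(* Only cylinders of arrows e_2: they already generate the sigma-algebra, and
   unlike general cylinders they cannot prescribe two different arrows at points
   of the same level. *)
Definition upcyl (s : seq Z2) : set config := [set w | all (w : Z2 -> bool) s].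

Lemma upcyl_cat s t : upcyl (s ++ t) = upcyl s `&` upcyl t.
Proof. by apply/seteqP; split=> w; rewrite /upcyl /= all_cat => /andP. Qed.

(** General cylinders, indexed by lists over a countable type so that any union of them is
    countable. *)
Definition pattern (p : seq (int * int * bool)) : set config :=
  [set w | all (fun q => w q.1 == q.2) p].

Lemma open_bigcup_pattern (U : set (prod_topology (fun _ : Z2 => arrow))) :
  open U -> U = \bigcup_(p in [set p | pattern p `<=` U]) pattern p.
Proof.
move=> oU; apply/seteqP; split=> [w Uw|w [p pU wp]]; last exact: pU.
(* The filter generated by agreement with [w] on finitely many sites. It converges to [w] in the
   product topology, since a subbasic neighbourhood depends on one site only; hence [U] contains a
   pattern around [w]. *)
pose F : set_system (prod_topology (fun _ : Z2 => arrow)) :=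
  [set V | exists s : seq (int * int),
    [set v | all (fun z => v z == w z) s] `<=` V].
have FF : Filter F.
  split=> [|V W [s sV] [t tW]|V W VW [s sV]].
  - by exists [::].
  - exists (s ++ t) => v /=; rewrite all_cat => /andP[vs vt].
    by split; [exact: sV|exact: tW].
  - by exists s; apply: subset_trans VW.
have : F --> (w : prod_topology (fun _ : Z2 => arrow)).
  apply/cvg_sup => z V /=.
  rewrite (@nbhsE (initial_topology (fun f : Z2 -> arrow => f z))).
  move=> -[B [[C oC <-] Cw] BV].
  exists [:: z] => v /=; rewrite andbT => /eqP vz.
  by apply: BV => /=; rewrite vz.
move=> /(_ U (open_nbhs_nbhs (conj oU Uw))) [s sU].
exists [seq (z, w z) | z <- s] => [v|] /=.
  rewrite /pattern /= all_map => vs; exact: sU.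
by rewrite /pattern /= all_map; apply/allP => z _ /=.
Qed.

(** Complements of one-site upward cylinders prescribe the other arrow, so upward cylinders generate
    all patterns, and open sets are countable unions of patterns. *)
Lemma config_measurableE : @measurable _ config = <<s range upcyl >>.
Proof.
have sG : sigma_algebra setT <<s range upcyl >> by exact: smallest_sigma_algebra.
apply/seteqP; split; last first.
  apply: smallest_sub; first exact: sigma_algebra_measurable.
  move=> _ [s _ <-]; elim: s => [|z s IHs].
    by rewrite [X in measurable X](_ : _ = setT)//; apply/seteqP.
  rewrite -cat1s upcyl_cat; apply: measurableI => //.
  rewrite [X in measurable X](_ : _ = [set w : config | w z = true]).
    exact: measurable_arrow.
  by apply/seteqP; split=> w; rewrite /upcyl /= andbT.
apply: smallest_sub => // U oU.
pose T := g_sigma_algebraType (range upcyl).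
have mup s : @measurable _ T (upcyl s) by apply: sub_sigma_algebra; exists s.
have mpat p : @measurable _ T (pattern p).
  elim: p => [|[z b] p IHp].
    by rewrite [X in measurable X](_ : _ = setT)//; apply/seteqP.
  rewrite [X in measurable X](_ : _ =
    (if b then upcyl [:: z] else ~` upcyl [:: z]) `&` pattern p).
    by apply: measurableI => //; case: b; [|apply: measurableC].
  by case: b; apply/seteqP; split=> w; rewrite /pattern /upcyl /= andbT;
   case: (w z) => //= -[].
rewrite (open_bigcup_pattern oU) bigcup_mkcond.
change (@measurable _ T (\bigcup_p
  (if p \in [set p | pattern p `<=` U] then pattern p else set0))).
apply: countable_bigcupT_measurable; first exact: countableP.
by move=> p; case: ifP.
Qed.

(** * Striped configurations and their walks *)

Definition level (z : Z2) : int := z.1 + z.2.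

Definition stripe (xi : int -> arrow) : config := fun z => xi (level z).

Lemma levelD (z t : Z2) : level (z + t) = level z + level t.
Proof. by rewrite /level /= addrACA. Qed.

Lemma level_arrow_vec a : level (arrow_vec a) = 1.
Proof. by case: a. Qed.

(* [shift] alone would refer to the translation of the analysis library. *)
Lemma shift_stripe (z : Z2) xi :
  Defs.shift z (stripe xi) = stripe (fun m => xi (m + level z)).
Proof. by apply/funext => t; rewrite /Defs.shift /stripe levelD. Qed.

(** Both arrows have level 1, so [T_alpha] shifts the bits by one whichever arrow it reads. *)
Lemma iter_T_alpha_stripe xi n :
  iter n T_alpha (stripe xi) = stripe (fun m => xi (m + n%:Z)).
Proof.
elim: n => [|n IHn]; first by apply/funext => t; rewrite /stripe /= addr0.
rewrite iterS IHn /T_alpha shift_stripe level_arrow_vec.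
by apply/funext => t; rewrite /stripe -addrA -intS.
Qed.

Lemma bi_infinite_stripe xi (z : Z2) : bi_infinite (stripe xi) z.
Proof.
apply/bi_infiniteP => n; elim: n z => [//|n IHn] z.
(* A predecessor of [z] lies one level below, and the bit there is the direction of the step into
   [z]. *)
exists (xi (level z - 1)) => //; split; last exact: IHn.
rewrite /= /stripe; congr (xi _).
apply: (addIr (level (arrow_vec (xi (level z - 1))))).
by rewrite -levelD subrK level_arrow_vec subrK.
Qed.

(** * The coin-tossing measure and its invariance *)

Section coin_tossing.
Context {R : realType}.

Lemma measurable_unit_itv : measurable (`[0, 1[%classic : set R).
Proof. exact: measurable_itv. Qed.

Definition uniform01 : set (measurableTypeR R) -> \bar R :=
  mrestr lebesgue_measure measurable_unit_itv.

HB.instance Definition _ := Measure.on uniform01.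

Lemma uniform01_setT : uniform01 setT = 1%E.
Proof.
rewrite /uniform01 /mrestr setTI.
by have := @lebesgue_digits_cyl R [::] isT; rewrite /digits_cyl set_true setIT.
Qed.

HB.instance Definition _ :=
  Measure_isProbability.Build _ _ R uniform01 uniform01_setT.

Definition coin_config (x : measurableTypeR R) : config :=
  stripe (fun m => digit (pickle m) x).

(** Sites of one level impose the same condition; [undup] leaves the distinct positions that the
    product formula for digits requires. *)
Lemma preimage_upcyl (s : seq Z2) : coin_config @^-1` upcyl s =
  digits_cyl [seq (pickle m, true) | m <- undup [seq level z | z <- s]].
Proof.
apply/seteqP; split=> x; rewrite /upcyl /digits_cyl /=.
  move=> /allP xs; apply/allP => _ /mapP[m + ->].
  by rewrite mem_undup => /mapP[z /xs zs ->] /=; apply/eqP.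
move=> /allP xs; apply/allP => z zs.
have := xs (pickle (level z), true); rewrite /= eqb_id.
by apply; apply: map_f; rewrite mem_undup map_f.
Qed.

Lemma measurable_coin_config : measurable_fun setT coin_config.
Proof.
apply: (measurability _ config_measurableE) => _ [_ [s _ <-] <-].
by rewrite setTI preimage_upcyl; exact: measurable_digits_cyl.
Qed.

HB.instance Definition _ := isMeasurableFun.Build _ _ _ _ coin_config
  measurable_coin_config.

Definition coin_prob : probability config R :=
  distribution uniform01 coin_config.

Lemma uniform01_digits_cyl (T : eqType) (f : T -> nat) (u : T -> bool)
    (s : seq T) : injective f -> uniq s ->
  uniform01 (digits_cyl [seq (f i, u i) | i <- s]) = (2^-1 ^+ size s)%:E.
Proof.
move=> finj us; rewrite /uniform01 /mrestr setIC.
rewrite lebesgue_digits_cyl ?size_map// /unzip1 -map_comp.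
by rewrite map_inj_uniq.
Qed.

Lemma coin_prob_upcyl s :
  coin_prob (upcyl s) = (2^-1 ^+ size (undup [seq level z | z <- s]))%:E.
Proof.
rewrite /coin_prob /= /distribution /pushforward preimage_upcyl.
by rewrite (@uniform01_digits_cyl _ pickle (fun=> true)) ?undup_uniq.
Qed.

Lemma preimage_shift_upcyl (z : Z2) s :
  Defs.shift z @^-1` upcyl s = upcyl [seq t + z | t <- s].
Proof. by apply/seteqP; split=> w; rewrite /upcyl /= all_map. Qed.

Lemma measurable_shift (z : Z2) : measurable_fun [set: config] (Defs.shift z).
Proof.
apply: (measurability _ config_measurableE) => _ [_ [s _ <-] <-].
rewrite setTI preimage_shift_upcyl config_measurableE.
by apply: sub_sigma_algebra; eexists.
Qed.

HB.instance Definition _ (z : Z2) := isMeasurableFun.Build _ _ _ _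
  (Defs.shift z) (measurable_shift z).

(** Upward cylinders form a generating pi-system, and the mass of one depends only on its number of
    distinct levels, which a translation preserves. *)
Lemma translation_invariant_coin_prob : translation_invariant coin_prob.
Proof.
move=> z B mB; change (distribution coin_prob (Defs.shift z) B = coin_prob B).
apply: (measure_unique (range upcyl) (fun=> setT)) => //.
- exact: config_measurableE.
- move=> _ _ [s _ <-] [t _ <-]; exists (s ++ t) => //.
  exact: upcyl_cat.
- by move=> _; exists [::] => //; apply/seteqP.
- by rewrite bigcup_const.
- move=> _ [s _ <-].
  change (coin_prob (Defs.shift z @^-1` upcyl s) = coin_prob (upcyl s)).
  rewrite preimage_shift_upcyl !coin_prob_upcyl -map_comp.
  rewrite (_ : [seq _ | _ <- s] = map (+%R^~ (level z)) (map level s)).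
    by rewrite undup_map_inj ?size_map//; exact: addIr.
  by rewrite -map_comp; apply: eq_map => t /=; rewrite levelD.
- by move=> _; rewrite (le_lt_trans (probability_le1 _ _))// ltry.
Qed.

(** * Entropy of the trajectory system *)

Lemma P_alpha_coin_probE A :
  P_alpha coin_prob A = uniform01 (coin_config @^-1` A).
Proof.
transitivity (uniform01 (coin_config @^-1` (A `&` Omega_alpha))) => //.
(* Every stripe lies in [Omega_alpha], so the restriction loses no mass. *)
congr (uniform01 _); apply/seteqP; split=> x /=; first by case.
by split=> //; exact: bi_infinite_stripe.
Qed.

Definition origin_cell (i : 'I_2) : set config :=
  [set w | w 0 = (i == 1)] `&` Omega_alpha.

(** The walk from the origin reads its i-th arrow on level i, so a word of length [n] prescribes [n]
    distinct digits. *)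
Lemma P_alpha_join_cell n (u : {ffun 'I_n -> 'I_2}) :
  P_alpha coin_prob (join_cell T_alpha origin_cell u) = (2^-1 ^+ n)%:E.
Proof.
rewrite P_alpha_coin_probE (_ : _ @^-1` _ = digits_cyl
  [seq (pickle (val i)%:Z, u i == 1) | i <- enum 'I_n]).
  rewrite (@uniform01_digits_cyl _ (fun i : 'I_n => pickle (val i)%:Z)).
  - by rewrite size_enum_ord.
  - by move=> i j /(pcan_inj pickleK) [] /val_inj.
  - exact: enum_uniq.
apply/seteqP; split=> x; rewrite /digits_cyl /join_cell /=.
  move=> xu; apply/allP => _ /mapP[i _ ->] /=; apply/eqP.
  have [/= <- _] := xu i.
  by rewrite iter_T_alpha_stripe /stripe /level /= !add0r.
move=> /allP xu i; split => /=; rewrite iter_T_alpha_stripe.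
  rewrite /stripe /level /= !add0r; apply/eqP.
  by apply: (xu (pickle (val i)%:Z, u i == 1)); apply: map_f; rewrite mem_enum.
exact: bi_infinite_stripe.
Qed.

Lemma shannon_join_cell n :
  shannon (P_alpha coin_prob) (@join_cell _ _ T_alpha 2 origin_cell n) =
  n%:R * ln 2 :> R.
Proof.
rewrite /shannon; under eq_bigr do rewrite P_alpha_join_cell /=.
rewrite sumr_const card_ffun !card_ord -[X in - X]mulr_natl natrX mulrA -exprMn.
rewrite divff ?expr1n ?mul1r//.
by rewrite lnXn ?invr_gt0// lnV ?posrE// mulNrn opprK mulr_natl.
Qed.

Lemma entropy_rate_coin :
  entropy_rate (P_alpha coin_prob) T_alpha origin_cell = ln 2 :> R.
Proof.
apply/cvg_lim => //; apply: (@cvg_trans _ (@cst nat R (ln 2) @ \oo)); last first.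
  exact: cvg_cst.
(* At n = 0 the quotient is 0 by the convention on division, so equality with ln 2 holds only
   eventually. *)
apply: near_eq_cvg; near=> n; rewrite shannon_join_cell mulrAC divff ?mul1r//.
rewrite pnatr_eq0 -lt0n; near: n; exact: nbhs_infty_gt.
Unshelve. all: by end_near. Qed.

Lemma measurable_partition_origin_cell :
  measurable_partition Omega_alpha origin_cell.
Proof.
split; last first.
  move=> i; apply: measurableI; last exact: measurable_Omega_alpha.
  exact: measurable_arrow.
split.
- apply/seteqP; split=> [w [i _ []]//|w Ow].
  exists (if w 0 then 1 else 0) => //; split=> //=.
  by case: (w 0).
- move=> i j _ _ [w [[/= wi _] [/= wj _]]].
  apply/val_inj; move: wi; rewrite wj.
  by case: i j {wj} => [[|[|//]] ?] [[|[|//]] ?].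
(* [partition] also asks for nonempty cells; constant stripes inhabit them. *)
- move=> i _; exists (stripe (fun=> i == 1)); split=> //=.
  exact: bi_infinite_stripe.
Qed.

End coin_tossing.

Theorem theorem2p5 (R : realType) :
  exists P : probability config R,
    [/\ translation_invariant P,
        {ae P, forall w : config, exists z : Z2, bi_infinite w z} &
        (0 < ks_entropy (P_alpha P) Omega_alpha T_alpha)%E].
Proof.
exists (@coin_prob R); split; first exact: translation_invariant_coin_prob.
(* The origin serves as the bi-infinite point, and no stripe lies in this exceptional set. *)
- exists (~` Omega_alpha); split.
  + by apply: measurableC; exact: measurable_Omega_alpha.
  + rewrite /coin_prob /= /distribution /pushforward.
    rewrite (_ : _ @^-1` _ = set0) ?measure0//; apply/seteqP; split=> // x /=.
    by apply; exact: bi_infinite_stripe.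
  + by move=> w /= + Ow; apply; exists 0.
- apply: (@lt_le_trans _ _ (ln 2 : R)%:E).
    by rewrite lte_fin ln_gt0// ltr1n.
  apply: ereal_sup_ubound; exists 2, origin_cell; split.
    exact: measurable_partition_origin_cell.
  by rewrite entropy_rate_coin.
Qed.
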